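(* Let $A\in\mathbb{R}^{m\times n}$, $b,z\in\mathbb{R}^m$, $\bar x\in\mathbb{R}^n$, $\gamma,\delta',\lambda_{\mathrm{tgt}},\tilde s,\gamma_{\mathrm{inc}},\gamma_{\mathrm{dec}},L_{\min}$ satisfy the Standing Assumption given in the context, and let $\lambda\ge\lambda_{\mathrm{tgt}}$. Let $\{x^{(k)}\}_{k\ge 0}$ be the sequence generated by Algorithm ProxGrad (run without invoking its stopping criterion) with regularization parameter $\lambda$, initial point $x^{(0)}\in\mathbb{R}^n$ and initial estimate $L_0\ge L_{\min}$. If $$\big\|x^{(0)}_{\bar S^c}\big\|_0\le\tilde s,\qquad \omega_\lambda(x^{(0)})\le\delta'\lambda,$$ then for all $k\ge 0$, $$\big\|x^{(k)}_{\bar S^c}\big\|_0\le\tilde s,\qquad \phi_\lambda(x^{(k)})-\phi_\lambda^\star\le\Big(1-\frac{1}{4\gamma_{\mathrm{inc}}\kappa}\Big)^k\big(\phi_\lambda(x^{(0)})-\phi_\lambda^\star\big),$$ where $\phi_\lambda^\star=\min_x\phi_\lambda(x)$ and $\kappa=\rho_+(A,\bar s+2\tilde s)/\rho_-(A,\bar s+2\tilde s)$.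
   Context: Notation. $f(x)=\frac12\|Ax-b\|_2^2$, so $\nabla f(x)=A^T(Ax-b)$; $\phi_\lambda(x)=f(x)+\lambda\|x\|_1$. The optimality residue is $\omega_\lambda(x)=\min_{\xi\in\partial\|x\|_1}\|\nabla f(x)+\lambda\xi\|_\infty$, where $\partial\|x\|_1$ is the subdifferential of the $\ell_1$ norm at $x$. $\|x\|_0$ is the number of nonzero entries of $x$; $\mathrm{supp}(x)=\{j:x_j\ne0\}$; $x_{S}$ is the restriction of $x$ to coordinates in $S$; $S^c$ is the complement of $S$ in $\{1,\dots,n\}$. Restricted eigenvalues. For an integer $s>0$, $\rho_+(A,s)=\sup\{x^TA^TAx/x^Tx: x\ne0,\|x\|_0\le s\}$ and $\rho_-(A,s)=\inf\{x^TA^TAx/x^Tx: x\ne0,\|x\|_0\le s\}$. Standing Assumption. $b=A\bar x+z$, $\bar S=\mathrm{supp}(\bar x)$, $\bar s=|\bar S|$; $\gamma_{\mathrm{inc}}>1$, $\gamma_{\mathrm{dec}}\ge1$, $\lambda_{\mathrm{tgt}}>0$; $\gamma>0$ and $\delta'\in(0,1)$ satisfy $\gamma>(1+\delta')/(1-\delta')$ and $$\lambda_{\mathrm{tgt}}\ge\max\Big\{4,\frac{\gamma+1}{(1-\delta')\gamma-(1+\delta')}\Big\}\|A^Tz\|_\infty;$$ $\tilde s$ is an integer with $\rho_-(A,\bar s+2\tilde s)>0$ and $$\tilde s>\frac{16\big(\gamma_{\mathrm{inc}}\rho_+(A,\bar s+2\tilde s)+2\rho_+(A,\tilde s)\big)}{\rho_-(A,\bar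 s+\tilde s)}(1+\gamma)\bar s;$$ and $0<L_{\min}\le\gamma_{\mathrm{inc}}\rho_+(A,\bar s+2\tilde s)$. Proximal step. For $L>0$, $\psi_{\lambda,L}(y;x)=f(y)+\nabla f(y)^T(x-y)+\frac L2\|x-y\|_2^2+\lambda\|x\|_1$ and $T_{\lambda,L}(y)=\arg\min_x\psi_{\lambda,L}(y;x)$. Algorithm LineSearch$(\lambda,x,L)$: repeat: set $x^+\leftarrow T_{\lambda,L}(x)$; if $\phi_\lambda(x^+)>\psi_{\lambda,L}(x;x^+)$ then $L\leftarrow L\gamma_{\mathrm{inc}}$; until $\phi_\lambda(x^+)\le\psi_{\lambda,L}(x;x^+)$. Return $\{x^+,M\}$ with $M=L$. Algorithm ProxGrad with inputs $\lambda>0$, precision $\hat\epsilon>0$, $x^{(0)}$, $L_0\ge L_{\min}$: for $k=0,1,2,\dots$ compute $\{x^{(k+1)},M_k\}\leftarrow$ LineSearch$(\lambda,x^{(k)},L_k)$ and set $L_{k+1}\leftarrow\max\{L_{\min},M_k/\gamma_{\mathrm{dec}}\}$; stop when $\omega_\lambda(x^{(k+1)})\le\hat\epsilon$. ''Without invoking the stopping criterion'' means the iteration is continued for all $k$.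
   Formalization: The formal theorem also assumes L_0 ≤ γ_inc ρ_+(A, s̄+2s̃), the bound already imposed on L_min; without it the claim is false, since the line search never decreases L and a very large L_0 makes the first step too short for the stated rate. *)

(* Defs.v *)
From HB Require Import structures.
From mathcomp Require Import all_boot all_order all_algebra.
From mathcomp Require Import all_classical all_reals all_analysis.
From mathcomp Require Import ring.

Set Implicit Arguments.
Unset Strict Implicit.
Unset Printing Implicit Defensive.

Import Order.TTheory GRing.Theory Num.Theory.
Import numFieldNormedType.Exports.

Local Open Scope classical_set_scope.
Local Open Scope ring_scope.

(* The l_infty norm of a vector is the library norm `|v| (see mx_normrE). *)

Definition dotv (R : realType) (n : nat) (u v : 'cV[R]_n) : R :=
  \sum_i u i 0 * v i 0.

Definition l1norm (R : realType) (n : nat) (v : 'cV[R]_n) : R :=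
  \sum_i `|v i 0|.

Definition sqnorm2 (R : realType) (n : nat) (v : 'cV[R]_n) : R :=
  \sum_i v i 0 ^+ 2.

Definition supp (R : realType) (n : nat) (v : 'cV[R]_n) : {set 'I_n} :=
  [set j | v j 0 != 0]%SET.

Definition l0norm (R : realType) (n : nat) (v : 'cV[R]_n) : nat := #|supp v|.

(* The restriction of v to S is kept in R^n, padded by zeros outside S. *)
Definition vrestrict (R : realType) (n : nat) (S : {set 'I_n})
    (v : 'cV[R]_n) : 'cV[R]_n :=
  \col_j (if j \in S then v j 0 else 0).

Definition subdifferential (R : realType) (n : nat) (g : 'cV[R]_n -> R)
    (x : 'cV[R]_n) : set 'cV[R]_n :=
  [set xi | forall y, g x + dotv xi (y - x) <= g y].

Definition is_argmin (R : realType) (T : Type) (g : T -> R) (x : T) : Prop :=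
  forall y, g x <= g y.

Definition lsq (R : realType) (m n : nat) (A : 'M[R]_(m, n)) (b : 'cV[R]_m)
    (x : 'cV[R]_n) : R :=
  2^-1 * sqnorm2 (A *m x - b).

Definition grad_lsq (R : realType) (m n : nat) (A : 'M[R]_(m, n))
    (b : 'cV[R]_m) (x : 'cV[R]_n) : 'cV[R]_n :=
  A^T *m (A *m x - b).

(* A^T (A x - b) is the gradient of lsq A b at x. *)
Lemma lsq_expand (R : realType) (m n : nat) (A : 'M[R]_(m, n)) (b : 'cV[R]_m)
    (x h : 'cV[R]_n) :
  lsq A b (x + h) =
  lsq A b x + dotv (grad_lsq A b x) h + 2^-1 * sqnorm2 (A *m h).
Proof.
have -> : dotv (grad_lsq A b x) h = dotv (A *m x - b) (A *m h).
  rewrite /dotv /grad_lsq; set u := A *m x - b.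
  transitivity (\sum_j \sum_i A i j * u i 0 * h j 0).
    apply: eq_bigr => j _; rewrite mxE mulr_suml.
    by apply: eq_bigr => i _; rewrite mxE.
  rewrite exchange_big /=; apply: eq_bigr => i _.
  rewrite [(A *m h) i 0]mxE mulr_sumr; apply: eq_bigr => j _.
  by rewrite mulrAC mulrC.
rewrite /lsq mulmxDr addrAC.
rewrite /sqnorm2 /dotv; set u := A *m x - b; set v := A *m h.
rewrite !mulr_sumr -!big_split /=; apply: eq_bigr => i _.
by rewrite mxE; field.
Qed.

Definition phi (R : realType) (m n : nat) (A : 'M[R]_(m, n)) (b : 'cV[R]_m)
    (lambda : R) (x : 'cV[R]_n) : R :=
  lsq A b x + lambda * l1norm x.

(* For 0 <= lambda the infimum is over a set that is bounded below by 0 and it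
   is attained, so this is the minimum value; likewise for omega, since the
   subdifferential of l1norm is nonempty and compact. *)
Definition phi_star (R : realType) (m n : nat) (A : 'M[R]_(m, n))
    (b : 'cV[R]_m) (lambda : R) : R :=
  inf (range (phi A b lambda)).

Definition omega (R : realType) (m n : nat) (A : 'M[R]_(m, n)) (b : 'cV[R]_m)
    (lambda : R) (x : 'cV[R]_n) : R :=
  inf [set `|grad_lsq A b x + lambda *: xi| |
        xi in subdifferential (@l1norm R n) x].

(* x^T A^T A x / x^T x over nonzero s-sparse x; this set is empty only when
   s = 0 or n = 0, in which case sup and inf below are 0. *)
Definition sparse_rayleigh (R : realType) (m n : nat) (A : 'M[R]_(m, n))
    (s : nat) : set R :=
  [set dotv x (A^T *m (A *m x)) / dotv x x |
     x in [set x : 'cV[R]_n | x != 0 /\ (l0norm x <= s)%N]].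

Definition rho_plus (R : realType) (m n : nat) (A : 'M[R]_(m, n)) (s : nat) : R :=
  sup (sparse_rayleigh A s).

Definition rho_minus (R : realType) (m n : nat) (A : 'M[R]_(m, n)) (s : nat) : R :=
  inf (sparse_rayleigh A s).

Definition psi (R : realType) (m n : nat) (A : 'M[R]_(m, n)) (b : 'cV[R]_m)
    (lambda L : R) (y x : 'cV[R]_n) : R :=
  lsq A b y + dotv (grad_lsq A b y) (x - y) + L / 2 * sqnorm2 (x - y)
  + lambda * l1norm x.

(* xp = T_{lambda,L}(y); the minimizer is unique as psi is strongly convex in
   its last argument for 0 < L. *)
Definition is_prox_step (R : realType) (m n : nat) (A : 'M[R]_(m, n))
    (b : 'cV[R]_m) (lambda L : R) (y xp : 'cV[R]_n) : Prop :=
  is_argmin (psi A b lambda L y) xp.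

(* line_search A b ginc lambda x L xp M: the repeat-until loop started at x
   with estimate L terminates and returns {xp, M}. *)
Inductive line_search (R : realType) (m n : nat) (A : 'M[R]_(m, n))
    (b : 'cV[R]_m) (ginc lambda : R) (x : 'cV[R]_n) :
    R -> 'cV[R]_n -> R -> Prop :=
| line_search_stop (L : R) (xp : 'cV[R]_n) :
    is_prox_step A b lambda L x xp ->
    phi A b lambda xp <= psi A b lambda L x xp ->
    line_search A b ginc lambda x L xp L
| line_search_retry (L : R) (xt xp : 'cV[R]_n) (M : R) :
    is_prox_step A b lambda L x xt ->
    psi A b lambda L x xt < phi A b lambda xt ->
    line_search A b ginc lambda x (L * ginc) xp M ->
    line_search A b ginc lambda x L xp M.

(* x is the sequence of iterates from x 0 with initial estimate L0, the
   stopping criterion being ignored. *)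
Definition prox_grad_run (R : realType) (m n : nat) (A : 'M[R]_(m, n))
    (b : 'cV[R]_m) (ginc gdec Lmin lambda L0 : R) (x : nat -> 'cV[R]_n) : Prop :=
  exists L M : nat -> R,
    L 0%N = L0 /\
    forall k : nat,
      line_search A b ginc lambda (x k) (L k) (x k.+1) (M k) /\
      L k.+1 = Num.max Lmin (M k / gdec).

(* Main.v *)
Require Import Defs.
From mathcomp Require Import all_boot all_order all_algebra.
From mathcomp Require Import all_classical all_reals all_analysis.
From mathcomp Require Import ring lra.

(** The objective is not strongly convex on the whole space, but it is along
    sparse directions. The proof shows that the iterates, and some global
    minimizer, have at most st nonzero entries outside the support of xbar.
    Differences of such points have at most |S| + 2 st nonzero entries, where S is
    the support of xbar, so that the usual linear rate of proximal gradient
    descent on a strongly convex function applies.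

    Write e = x - xbar, Lf = rho_plus A (|S| + 2 st), mu = rho_minus A (|S| + 2 st)
    and D = (1 + gamma) lambda |S| / rho_minus A (|S| + st). Call a point good when
    it has at most st nonzero entries off S and phi x <= phi xbar + 2 lambda D.

    - The initial point is good ([sublevel_of_small_residue]). A small residue
      says that phi x exceeds phi xbar by at most delta' lambda |e|_1. Since the
      noise A^T z is dominated by lambda, the penalty then forces e into the cone
      |e_off|_1 <= gamma |e_on|_1, where e_on and e_off are the parts of e on and
      off S, and restricted strong convexity bounds |e_on|_1.

    - A good point has |e_off|_1 <= 4 D and |A e|^2 <= 16 lambda D
      ([sublevel_errors]).

    - A proximal step with 0 < L <= ginc Lf from a good point is again sparse
      off S ([prox_step_sparse]). An entry that survives soft thresholding
      satisfies |L x_j - (grad f(x))_j| >= lambda. If st entries off S survived,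
      testing these inequalities against a sign vector supported on them would
      give lambda st <= L |e_off|_1 + sqrt (rho_plus A st * st * |A e|^2)
      + lambda st / 4, which the lower bound on st excludes.

    - Hence the backtracking test is passed as soon as L >= Lf: trial points are
      sparse, and along sparse directions f has curvature at most Lf. So
      M <= ginc Lf, phi does not increase, and goodness is preserved
      ([line_search_region]).

    - A minimizer of phi among the points that are sparse off S exists by
      compactness ([sparse_minimizer]). A proximal step from it with L = Lf stays
      sparse, hence cannot decrease phi; so this minimizer is a fixed point of the
      proximal map, and by convexity it minimizes phi globally
      ([region_minimizer]).

    - Comparing the proximal step with the point x + a (xs - x) on the segment
      towards that minimizer xs, for a = mu / (2 ginc Lf), gives the contraction
      factor ([prox_step_contraction]). *)

Set Implicit Arguments.
Unset Strict Implicit.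
Unset Printing Implicit Defensive.

Import Order.TTheory GRing.Theory Num.Theory.
Import numFieldNormedType.Exports.

Local Open Scope ring_scope.

(** * Norms and inner products *)

Section VectorAlgebra.
Context {R : realType}.

Lemma dotvE n (u v : 'cV[R]_n) : dotv u v = (u^T *m v) 0 0.
Proof. by rewrite mxE; apply: eq_bigr => i _; rewrite mxE. Qed.

Lemma dotvC n (u v : 'cV[R]_n) : dotv u v = dotv v u.
Proof. by apply: eq_bigr => i _; rewrite mulrC. Qed.

Lemma dotvDr n (u v w : 'cV[R]_n) : dotv u (v + w) = dotv u v + dotv u w.
Proof. by rewrite !dotvE mulmxDr mxE. Qed.

Lemma dotvDl n (u v w : 'cV[R]_n) : dotv (u + v) w = dotv u w + dotv v w.
Proof. by rewrite dotvC dotvDr !(dotvC w). Qed.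

Lemma dotvZr n a (u v : 'cV[R]_n) : dotv u (a *: v) = a * dotv u v.
Proof. by rewrite !dotvE -scalemxAr mxE. Qed.

Lemma dotvZl n a (u v : 'cV[R]_n) : dotv (a *: u) v = a * dotv u v.
Proof. by rewrite dotvC dotvZr dotvC. Qed.

Lemma dotvNl n (u v : 'cV[R]_n) : dotv (- u) v = - dotv u v.
Proof. by rewrite -scaleN1r dotvZl mulN1r. Qed.

Lemma dotvNr n (u v : 'cV[R]_n) : dotv u (- v) = - dotv u v.
Proof. by rewrite dotvC dotvNl dotvC. Qed.

Lemma dotv_trmx m n (A : 'M[R]_(m, n)) u v : dotv (A^T *m u) v = dotv u (A *m v).
Proof. by rewrite !dotvE trmx_mul trmxK mulmxA. Qed.

Lemma dotvv n (u : 'cV[R]_n) : dotv u u = sqnorm2 u.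
Proof. by apply: eq_bigr => i _; rewrite expr2. Qed.

Lemma sqnorm2_ge0 n (u : 'cV[R]_n) : 0 <= sqnorm2 u.
Proof. by apply: sumr_ge0 => i _; rewrite sqr_ge0. Qed.

Lemma sqnorm2Z n a (u : 'cV[R]_n) : sqnorm2 (a *: u) = a ^+ 2 * sqnorm2 u.
Proof. by rewrite -!dotvv dotvZl dotvZr mulrA. Qed.

Lemma sqnorm2B n (u v : 'cV[R]_n) : sqnorm2 (u - v) = sqnorm2 (v - u).
Proof. by rewrite -opprB -scaleN1r sqnorm2Z sqrrN expr1n mul1r. Qed.

Lemma sqnorm2_gt0 n (u : 'cV[R]_n) : u != 0 -> 0 < sqnorm2 u.
Proof.
move=> u0; rewrite lt_neqAle sqnorm2_ge0 andbT eq_sym.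
apply: contra u0 => /eqP /psumr_eq0P u0; apply/eqP/colP => i.
by rewrite mxE; apply/eqP; rewrite -sqrf_eq0 u0// => j _; rewrite sqr_ge0.
Qed.

Lemma dotv_young n (u v : 'cV[R]_n) : 2 * dotv u v <= sqnorm2 u + sqnorm2 v.
Proof.
rewrite mulr_sumr -big_split; apply: ler_sum => i _ /=.
by rewrite -subr_ge0 [X in 0 <= X](_ : _ = (u i 0 - v i 0) ^+ 2) ?sqr_ge0//; ring.
Qed.

Lemma l1norm_ge0 n (u : 'cV[R]_n) : 0 <= l1norm u.
Proof. exact: sumr_ge0. Qed.

Lemma l1normD n (u v : 'cV[R]_n) : l1norm (u + v) <= l1norm u + l1norm v.
Proof.
by rewrite -big_split; apply: ler_sum => i _; rewrite mxE ler_normD.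
Qed.

Lemma l1normZ n a (u : 'cV[R]_n) : l1norm (a *: u) = `|a| * l1norm u.
Proof. by rewrite mulr_sumr; apply: eq_bigr => i _; rewrite mxE normrM. Qed.

Lemma l1norm_conv n t (x y : 'cV[R]_n) : 0 <= t <= 1 ->
  l1norm (x + t *: (y - x)) <= (1 - t) * l1norm x + t * l1norm y.
Proof.
move=> /andP[t0 t1].
rewrite (_ : x + _ = (1 - t) *: x + t *: y); last first.
  by rewrite scalerBr scalerBl scale1r addrA addrAC.
by rewrite (le_trans (l1normD _ _))// !l1normZ !ger0_norm ?subr_ge0.
Qed.

Lemma mx_entry_le_norm n (u : 'cV[R]_n) i : `|u i 0| <= `|u|.
Proof.
rewrite [leRHS]/Num.Def.normr /= mx_normrE.
by apply/bigmax_geP; right => /=; exists (i, 0).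
Qed.

Lemma dotv_le_norm n (u v : 'cV[R]_n) : `|dotv u v| <= `|u| * l1norm v.
Proof.
rewrite mulr_sumr (le_trans (ler_norm_sum _ _ _))//; apply: ler_sum => i _.
by rewrite normrM ler_wpM2r// mx_entry_le_norm.
Qed.

Lemma dotv_cauchy_schwarz n (u v : 'cV[R]_n) :
  dotv u v ^+ 2 <= sqnorm2 u * sqnorm2 v.
Proof.
have [->|v0] := eqVneq v 0.
  by rewrite /dotv big1 ?expr0n ?mulr_ge0 ?sqnorm2_ge0// => i _; rewrite mxE mulr0.
have := dotv_young (sqnorm2 v *: u) (dotv u v *: v).
rewrite !sqnorm2Z dotvZl dotvZr => h.
have {}h : 0 <= sqnorm2 v * (sqnorm2 u * sqnorm2 v - dotv u v ^+ 2) by lra.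
by rewrite pmulr_rge0 ?sqnorm2_gt0// subr_ge0 in h.
Qed.

Definition signv n (S : {set 'I_n}) (v : 'cV[R]_n) : 'cV[R]_n :=
  \col_i (if i \in S then Num.sg (v i 0) else 0).

Lemma dotv_signv n (S : {set 'I_n}) (v : 'cV[R]_n) :
  dotv (signv S v) v = \sum_(i in S) `|v i 0|.
Proof.
rewrite [RHS]big_mkcond; apply: eq_bigr => i _; rewrite mxE.
by case: ifP => _; rewrite ?mul0r// normrEsg.
Qed.

Lemma sqnorm2_signv n (S : {set 'I_n}) (v : 'cV[R]_n) :
  sqnorm2 (signv S v) <= #|S|%:R.
Proof.
rewrite -sum1_card natr_sum [leRHS]big_mkcond; apply: ler_sum => i _.
rewrite mxE; case: ifP => _; rewrite ?expr0n//.
by rewrite sqr_sg lern1 leq_b1.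
Qed.

Lemma l1norm_signv n (S : {set 'I_n}) (v : 'cV[R]_n) :
  l1norm (signv S v) <= #|S|%:R.
Proof.
rewrite -sum1_card natr_sum [leRHS]big_mkcond; apply: ler_sum => i _.
rewrite mxE; case: ifP => _; rewrite ?normr0//.
by rewrite normr_sg lern1 leq_b1.
Qed.

Lemma supp_signv n (S : {set 'I_n}) (v : 'cV[R]_n) : supp (signv S v) \subset S.
Proof.
by apply/fintype.subsetP => i; rewrite !inE mxE; case: ifP => //; rewrite eqxx.
Qed.

Lemma sqr_sum_le_card_sqnorm2 n (S : {set 'I_n}) (u : 'cV[R]_n) :
  (\sum_(i in S) `|u i 0|) ^+ 2 <= #|S|%:R * sqnorm2 u.
Proof.
rewrite -dotv_signv (le_trans (dotv_cauchy_schwarz _ _))//.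
by rewrite ler_wpM2r ?sqnorm2_ge0 ?sqnorm2_signv.
Qed.

(** Makes the set whose infimum defines [omega] nonempty. *)
Lemma signv_subgradient n (v : 'cV[R]_n) :
  subdifferential (@l1norm R n) v (signv [set: 'I_n] v).
Proof.
move=> y; rewrite -lerBrDl -sumrB; apply: ler_sum => i _.
rewrite !mxE inE mulrBr -normrEsg lerD2r (le_trans (ler_norm _))// normrM.
by rewrite ler_piMl// normr_sg lern1 leq_b1.
Qed.

End VectorAlgebra.

(** The limit t -> 0, in the form in which first-order optimality conditions and
    infima that need not be attained are used below. *)
Lemma ge0_of_small_errors {R : realFieldType} (p q : R) :
  (forall t, 0 < t <= 1 -> 0 <= p + t * q) -> 0 <= p.
Proof.
move=> h; rewrite leNgt; apply/negP => p0.
have q0 : 0 < `|q| + 1 by rewrite ltr_wpDl.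
pose t := Num.min 1 (- p / 2 / (`|q| + 1)).
have t0 : 0 < t by rewrite lt_min ltr01 !divr_gt0// oppr_gt0.
have := h t; rewrite t0 ge_min lexx => /(_ isT).
have tq : t * (`|q| + 1) <= - p / 2 by rewrite -ler_pdivlMr// ge_min lexx orbT.
have : t * q <= t * (`|q| + 1).
  by rewrite ler_pM2l// (le_trans (ler_norm q))// lerDl.
lra.
Qed.

(** * Sparse vectors *)

Section SparseVectors.
Context {R : realType}.

Definition sparse_off n (S : {set 'I_n}) (s : nat) (x : 'cV[R]_n) :=
  (#|supp x :\: S| <= s)%N.

Lemma l0norm_vrestrictC n (S : {set 'I_n}) (x : 'cV[R]_n) :
  l0norm (vrestrict (~: S)%SET x) = #|supp x :\: S|.
Proof.
apply: eq_card => j; rewrite !inE mxE !inE; case: (j \in S) => //=.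
by rewrite eqxx.
Qed.

Lemma suppB n (x y : 'cV[R]_n) : supp (x - y) \subset supp x :|: supp y.
Proof.
apply/fintype.subsetP => j; rewrite !inE !mxE; apply: contraR.
by rewrite negb_or !negbK => /andP[/eqP -> /eqP ->]; rewrite subrr.
Qed.

(** Entries on S are counted once for both vectors; hence |S| + 2 st for a
    difference of two iterates. *)
Lemma l0normB n (S : {set 'I_n}) (x y : 'cV[R]_n) s t :
  sparse_off S s x -> sparse_off S t y ->
  (l0norm (x - y) <= #|S| + (s + t))%N.
Proof.
move=> hx hy.
have : supp (x - y) \subset S :|: ((supp x :\: S) :|: (supp y :\: S)).
  apply: fintype.subset_trans (suppB x y) _; apply/fintype.subsetP => j.
  by rewrite !inE; case: (x j 0 != 0); case: (y j 0 != 0); case: (j \in S).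
move=> /subset_leq_card /leq_trans; apply.
rewrite (leq_trans (leq_card_setU _ _))// leq_add2l.
by rewrite (leq_trans (leq_card_setU _ _))// leq_add.
Qed.

End SparseVectors.

Section RestrictedEigenvalues.
Context {R : realType} {m n : nat}.
Variable A : 'M[R]_(m, n).

Lemma dotv_gram (x : 'cV[R]_n) : dotv x (A^T *m (A *m x)) = sqnorm2 (A *m x).
Proof. by rewrite dotvC dotv_trmx dotvv. Qed.

Lemma sqnorm2_mulmx_bounded : exists C, forall x,
  sqnorm2 (A *m x) <= C * sqnorm2 x.
Proof.
exists (\sum_i sqnorm2 (row i A)^T) => x.
rewrite mulr_suml [leLHS]/sqnorm2; apply: ler_sum => i _.
rewrite (_ : (A *m x) i 0 = dotv (row i A)^T x) ?dotv_cauchy_schwarz//.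
by rewrite dotvE trmxK -row_mul [RHS]mxE.
Qed.

Lemma sparse_rayleigh_has_ubound s : has_ubound (sparse_rayleigh A s).
Proof.
have [C hC] := sqnorm2_mulmx_bounded; exists C => _ [y [y0 _] <-].
by rewrite dotv_gram dotvv ler_pdivrMr ?sqnorm2_gt0.
Qed.

Lemma rho_minus_le s (x : 'cV[R]_n) : (l0norm x <= s)%N ->
  rho_minus A s * sqnorm2 x <= sqnorm2 (A *m x).
Proof.
move=> xs; have [->|x0] := eqVneq x 0.
  by rewrite mulmx0 /sqnorm2 !big1 ?mulr0// => i _; rewrite mxE expr0n.
rewrite -ler_pdivlMr ?sqnorm2_gt0//; apply: ge_inf.
  exists 0 => _ [y _ <-]; rewrite dotv_gram dotvv.
  by rewrite divr_ge0 ?sqnorm2_ge0.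
by exists x => //; rewrite dotv_gram dotvv.
Qed.

Lemma rho_plus_ge s (x : 'cV[R]_n) : (l0norm x <= s)%N ->
  sqnorm2 (A *m x) <= rho_plus A s * sqnorm2 x.
Proof.
move=> xs; have [->|x0] := eqVneq x 0.
  by rewrite mulmx0 /sqnorm2 !big1 ?mulr0// => i _; rewrite mxE expr0n.
rewrite -ler_pdivrMr ?sqnorm2_gt0//.
apply: (ub_le_sup (sparse_rayleigh_has_ubound s)).
by exists x => //; rewrite dotv_gram dotvv.
Qed.

Lemma rho_minus_ge0 s : 0 <= rho_minus A s.
Proof.
have [h|/set0P h] := eqVneq (sparse_rayleigh A s) set0.
  by rewrite /rho_minus h inf0.
apply: lb_le_inf => // _ [y _ <-].
by rewrite dotv_gram dotvv divr_ge0 ?sqnorm2_ge0.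
Qed.

Lemma rho_plus_ge0 s : 0 <= rho_plus A s.
Proof.
have [h|/set0P[r hr]] := eqVneq (sparse_rayleigh A s) set0.
  by rewrite /rho_plus h sup0.
apply: le_trans (ub_le_sup (sparse_rayleigh_has_ubound s) hr).
case: hr => y _ <-.
by rewrite dotv_gram dotvv divr_ge0 ?sqnorm2_ge0.
Qed.

(** The infimum of the empty set is 0, so positivity excludes the degenerate
    cases s = 0 and n = 0. *)
Lemma sparse_rayleigh_nonempty s : 0 < rho_minus A s ->
  (sparse_rayleigh A s !=set0)%classic.
Proof.
move=> h; apply/set0P/negP => /eqP e.
by move: h; rewrite /rho_minus e inf0 ltxx.
Qed.

Lemma rho_minus_le_plus s : 0 < rho_minus A s -> rho_minus A s <= rho_plus A s.
Proof.
move=> /sparse_rayleigh_nonempty[_ [y [y0 ys] _]].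
have := le_trans (rho_minus_le ys) (rho_plus_ge ys).
by rewrite ler_pM2r// sqnorm2_gt0.
Qed.

(** The larger sparsity level minimizes over a larger set; the hypothesis 0 < s
    keeps the smaller set nonempty, a basis vector being a member. *)
Lemma rho_minus_anti s t : (0 < s <= t)%N -> 0 < rho_minus A t ->
  rho_minus A t <= rho_minus A s.
Proof.
move=> /andP[s0 st] ht; have [_ [y [y0 _] _]] := sparse_rayleigh_nonempty ht.
have [j yj] : exists j, y j 0 != 0.
  apply/existsP; apply: contraR y0; rewrite negb_exists => /forallP y0.
  by apply/eqP/colP => j; rewrite mxE; apply/eqP/negPn.
have dj : (delta_mx j 0 : 'cV[R]_n) != 0.
  by apply/eqP => /colP /(_ j); rewrite !mxE !eqxx => /eqP; rewrite oner_eq0.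
apply: lb_le_inf.
  exists (dotv (delta_mx j 0) (A^T *m (A *m delta_mx j 0)) /
          dotv (delta_mx j 0) (delta_mx j 0)); exists (delta_mx j 0) => //.
  split=> //; apply: leq_trans s0.
  suff: (l0norm (delta_mx j 0%R : 'cV[R]_n) <= #|[set j]%SET|)%N by rewrite cards1.
  apply/subset_leq_card/fintype.subsetP => i; rewrite !inE mxE eqxx andbT.
  by case: (i == j) => //; rewrite eqxx.
move=> _ [x [x0 xs] <-]; rewrite dotv_gram dotvv ler_pdivlMr ?sqnorm2_gt0//.
exact: rho_minus_le (leq_trans xs st).
Qed.

End RestrictedEigenvalues.

(** * The objective and its quadratic model *)

Section Objective.
Context {R : realType} {m n : nat}.
Variables (A : 'M[R]_(m, n)) (b : 'cV[R]_m) (lambda : R).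
Hypothesis lambda_ge0 : 0 <= lambda.

Lemma lsq_ge0 x : 0 <= lsq A b x.
Proof. by rewrite mulr_ge0 ?invr_ge0 ?sqnorm2_ge0. Qed.

Lemma lsq_taylor x y : lsq A b y =
  lsq A b x + dotv (grad_lsq A b x) (y - x) + 2^-1 * sqnorm2 (A *m (y - x)).
Proof. by rewrite -lsq_expand addrC subrK. Qed.

Lemma psi_self L x : psi A b lambda L x x = phi A b lambda x.
Proof.
by rewrite /psi subrr -[0](scale0r x) dotvZr sqnorm2Z expr0n !mul0r mulr0 !addr0.
Qed.

Lemma phi_psi L x y : phi A b lambda y =
  psi A b lambda L x y + 2^-1 * sqnorm2 (A *m (y - x)) - L / 2 * sqnorm2 (y - x).
Proof. by rewrite /phi (lsq_taylor x) /psi; ring. Qed.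

(** All that is used of the residue: f is its own second-order expansion and
    the l1 norm lies above its subgradient xi, so phi y - phi x is at least
    the pairing of grad f(x) + lambda xi with y - x, plus the quadratic term. *)
Lemma omega_descent c x : omega A b lambda x <= c -> forall y,
  phi A b lambda x + 2^-1 * sqnorm2 (A *m (y - x))
    <= phi A b lambda y + c * l1norm (y - x).
Proof.
move=> hc y; rewrite -subr_ge0.
apply: (@ge0_of_small_errors _ _ (l1norm (y - x))) => t /andP[t0 _].
set V := [set `|grad_lsq A b x + lambda *: xi| |
             xi in subdifferential (@l1norm R n) x]%classic.
have infV : has_inf V.
  split; last by exists 0 => _ [xi _ <-].
  exists `|grad_lsq A b x + lambda *: signv [set: 'I_n]%SET x|.
  by exists (signv [set: 'I_n]%SET x) => //; exact: signv_subgradient.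
have [_ [xi hxi <-] ht] := inf_adherent t0 infV.
have {}ht : `|grad_lsq A b x + lambda *: xi| <= c + t.
  by rewrite (le_trans (ltW ht))// lerD2r.
have hd : - ((c + t) * l1norm (y - x)) <=
    dotv (grad_lsq A b x) (y - x) + lambda * dotv xi (y - x).
  rewrite -dotvZl -dotvDl lerNl (le_trans (ler_norm _))// normrN.
  by rewrite (le_trans (dotv_le_norm _ _))// ler_wpM2r ?l1norm_ge0.
have := ler_wpM2l lambda_ge0 (hxi y).
rewrite /phi (lsq_taylor x y); lra.
Qed.

Definition psi_coord L g v u := g * (u - v) + L / 2 * (u - v) ^+ 2 + lambda * `|u|.

Lemma psi_separable L x y : psi A b lambda L x y =
  lsq A b x + \sum_j psi_coord L (grad_lsq A b x j 0) (x j 0) (y j 0).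
Proof.
rewrite /psi -!addrA; congr (_ + _).
rewrite /dotv /sqnorm2 /l1norm !mulr_sumr -!big_split.
by apply: eq_bigr => j _ /=; rewrite !mxE /psi_coord addrA.
Qed.

(** Soft thresholding: up to a constant the function is
    L / 2 u^2 - c u + lambda |u| with c = L v - g, and its minimizer is c shrunk
    by lambda towards 0 and divided by L. *)
Lemma psi_coord_min L g v : 0 < L ->
  exists u, forall w, psi_coord L g v u <= psi_coord L g v w.
Proof.
move=> L0; set c := L * v - g.
have E w : psi_coord L g v w =
    L / 2 * w ^+ 2 - c * w + lambda * `|w| + (L / 2 * v ^+ 2 - g * v).
  by rewrite /psi_coord /c; field.
suff [u hu] : exists u, forall w, L / 2 * u ^+ 2 - c * u + lambda * `|u| <=
    L / 2 * w ^+ 2 - c * w + lambda * `|w|.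
  by exists u => w; rewrite !E lerD2r.
have sq d w : L / 2 * (d / L) ^+ 2 - d * (d / L) <= L / 2 * w ^+ 2 - d * w.
  rewrite -subr_ge0 [X in 0 <= X](_ : _ = L / 2 * (w - d / L) ^+ 2).
    by rewrite mulr_ge0 ?sqr_ge0// divr_ge0// ltW.
  by field; rewrite gt_eqF.
have absl w : lambda * w <= lambda * `|w| by rewrite ler_wpM2l ?ler_norm.
have absr w : - (lambda * w) <= lambda * `|w|.
  by rewrite -mulrN ler_wpM2l// -normrN ler_norm.
have [c1|c1] := lerP lambda c.
  exists ((c - lambda) / L) => w.
  rewrite [`|(_ / L)|]ger0_norm ?divr_ge0 ?subr_ge0 ?(ltW L0)//.
  by move: (sq (c - lambda) w) (absl w); set U := (_ / L); lra.
have [c2|c2] := lerP c (- lambda).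
  exists ((c + lambda) / L) => w.
  rewrite [`|(_ / L)|]ler0_norm; last first.
    by rewrite pmulr_lle0 ?invr_gt0//; lra.
  by move: (sq (c + lambda) w) (absr w); set U := (_ / L); lra.
exists 0 => w; rewrite normr0 expr0n !mulr0 subr0 addr0.
have w2 : 0 <= L / 2 * w ^+ 2 by rewrite mulr_ge0 ?sqr_ge0// divr_ge0// ltW.
suff : c * w <= lambda * `|w| by lra.
rewrite (le_trans (ler_norm _))// normrM ler_wpM2r// ler_norml.
by rewrite !ltW.
Qed.

Lemma prox_step_exists L x : 0 < L -> exists y, is_prox_step A b lambda L x y.
Proof.
move=> L0.
have /choice[u hu] j := psi_coord_min (grad_lsq A b x j 0) (x j 0) L0.
exists (\col_j u j) => w; rewrite !psi_separable lerD2l.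
by apply: ler_sum => j _; rewrite [(\col__ _) j 0]mxE; exact: hu.
Qed.

(** Comparing y with the vector obtained by zeroing its j-th entry is enough:
    this gives y_j (L x_j - g_j) >= lambda |y_j| + L / 2 y_j^2. *)
Lemma prox_step_threshold L x y j : 0 <= L -> is_prox_step A b lambda L x y ->
  y j 0 != 0 -> lambda <= `|L * x j 0 - grad_lsq A b x j 0|.
Proof.
move=> L0 hy yj; set g := grad_lsq A b x j 0.
have := hy (\col_i if i == j then 0 else y i 0).
rewrite !psi_separable lerD2l (bigD1 j)//= [leRHS](bigD1 j)//= mxE eqxx.
rewrite (eq_bigr (fun i => psi_coord L (grad_lsq A b x i 0) (x i 0)
    ((\col_i if i == j then 0 else y i 0) i 0))); last first.
  by move=> i ij; rewrite mxE (negbTE ij).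
rewrite lerD2r /psi_coord normr0 -/g => h.
have y0 : 0 < `|y j 0| by rewrite normr_gt0.
rewrite -(ler_pM2r y0) -normrM (le_trans _ (ler_norm _))//.
have : 0 <= L / 2 * y j 0 ^+ 2 by rewrite mulr_ge0 ?sqr_ge0// divr_ge0.
lra.
Qed.

(** Optimality of x for the model at x, tested at x + t (y - x), gives after
    t -> 0 the variational inequality for phi at x; adding the exact quadratic
    remainder of f yields the growth term. In particular x is a global
    minimizer. *)
Lemma prox_fixpoint_growth L x : is_prox_step A b lambda L x x -> forall y,
  phi A b lambda x + 2^-1 * sqnorm2 (A *m (y - x)) <= phi A b lambda y.
Proof.
move=> hx y; rewrite -subr_ge0.
apply: (@ge0_of_small_errors _ _ (L / 2 * sqnorm2 (y - x))) => t /andP[t0 t1].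
have := hx (x + t *: (y - x)).
rewrite psi_self /psi (addrAC x) subrr add0r dotvZr sqnorm2Z.
have := ler_wpM2l lambda_ge0 (@l1norm_conv R n t x y _).
rewrite (ltW t0) t1 => /(_ isT).
rewrite /phi (lsq_taylor x y) -(pmulr_rge0 _ t0); lra.
Qed.

End Objective.

(** * Existence of a sparse minimizer *)

Section SparseMinimizer.
Context {R : realType} {m n : nat}.
Variables (A : 'M[R]_(m, n)) (b : 'cV[R]_m) (lambda : R).
Hypothesis lambda_gt0 : 0 < lambda.

Lemma phi_cvg (T : Type) (F : set_system T) {FF : Filter F} (u : T -> 'cV[R]_n)
    (v : 'cV[R]_n) :
  (forall j, u t j 0 @[t --> F] --> v j 0)%classic ->
  (phi A b lambda (u t) @[t --> F] --> phi A b lambda v)%classic.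
Proof.
move=> uv.
have sumc (I : finType) (f : I -> T -> R) (l : I -> R) :
    (forall i, f i t @[t --> F] --> l i)%classic ->
    (\sum_i f i t @[t --> F] --> \sum_i l i)%classic.
  move=> h; apply: (@cvg_big R I +%R 0 xpredT
    (@pseudometric_normed_Zmodule.add_continuous R R^o)) => // i _; exact: h.
have resid i : ((A *m u t - b) i 0 @[t --> F] --> (A *m v - b) i 0)%classic.
  rewrite (_ : (fun t => _) = fun t => \sum_j A i j * u t j 0 - b i 0).
    rewrite !mxE; apply: cvgB; last exact: cvg_cst.
    by apply: sumc => j; apply: cvgM; [exact: cvg_cst | exact: uv].
  by apply/funext => t; rewrite !mxE.
apply: cvgD; apply: cvgM; try exact: cvg_cst.
  by apply: sumc => i; apply: cvgM; exact: resid.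
by apply: sumc => j; apply: cvg_norm; exact: uv.
Qed.

Lemma phi_trmx_continuous : continuous (fun v : 'rV[R]_n => phi A b lambda v^T).
Proof.
move=> v; apply: phi_cvg => [|j]; first exact: nbhs_filter.
rewrite mxE (_ : (fun w : 'rV[R]_n => w^T j 0) = fun w => w 0 j).
  exact: coord_continuous.
by apply/funext => w; rewrite mxE.
Qed.

Lemma l1norm_le_phi (x : 'cV[R]_n) : lambda * l1norm x <= phi A b lambda x.
Proof. by rewrite lerDr lsq_ge0. Qed.

(** The vectors supported on T with entries in [-M, M] form a product of compact
    sets; M = phi 0 / lambda is large enough because lambda |y|_1 <= phi y. *)
Lemma supported_minimizer (T : {set 'I_n}) : exists x : 'cV[R]_n,
  supp x \subset T /\
  forall y : 'cV[R]_n, supp y \subset T -> phi A b lambda x <= phi A b lambda y.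
Proof.
set M := phi A b lambda 0 / lambda.
pose box (j : 'I_n) : set R :=
  if j \in T then `[- M, M]%classic else [set 0]%classic.
pose K := [set v : 'rV[R]_n | forall j, box j (v ord0 j)]%classic.
have M0 : 0 <= M.
  by rewrite divr_ge0 ?(le_trans _ (l1norm_le_phi _)) ?mulr_ge0 ?l1norm_ge0 ?ltW.
have K0 : K 0.
  by move=> j; rewrite /box mxE; case: ifP => //= _; rewrite in_itv /= M0 oppr_le0 M0.
have cK : compact K.
  apply: (@rV_compact R n box) => j; rewrite /box.
  by case: ifP => _; [exact: segment_compact | exact: compact_set1].
have cphi : {within K, continuous (fun v : 'rV[R]_n => phi A b lambda v^T)}%classic.
  exact/continuous_subspaceT/phi_trmx_continuous.
have [v /set_mem Kv vmin] := compact_EVT_min (ex_intro _ 0 K0) cK cphi.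
exists v^T; split.
  apply/fintype.subsetP => j; rewrite inE mxE; apply: contraR => jT.
  by have := Kv j; rewrite /box (negbTE jT) => ->.
move=> y yT; have [yM|yM] := leP (phi A b lambda y) (phi A b lambda 0).
  have -> : y = (y^T)^T by rewrite trmxK.
  apply: vmin; apply/mem_set => j; rewrite /box mxE.
  case: ifPn => jT /=.
    rewrite in_itv /= -ler_norml ler_pdivlMr// mulrC.
    apply: le_trans yM; apply: le_trans (l1norm_le_phi _).
    by rewrite ler_pM2l// /l1norm (bigD1 j)//= lerDl sumr_ge0.
  by apply/eqP; apply: contraR jT => yj; apply: (fintype.subsetP yT); rewrite inE.
rewrite (le_trans _ (ltW yM))//.
by have := vmin 0 (mem_set K0); rewrite trmx0.
Qed.

(** The sparsity constraint is not convex, but it is a finite union of the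
    coordinate subspaces treated above. *)
Lemma sparse_minimizer (S : {set 'I_n}) (s : nat) : exists2 x : 'cV[R]_n,
  sparse_off S s x &
  forall y : 'cV[R]_n, sparse_off S s y ->
    phi A b lambda x <= phi A b lambda y.
Proof.
have [f hf] := choice supported_minimizer.
have P0 : (#|finset.set0 :\: S| <= s)%N by rewrite finset.set0D cards0.
case: (Order.TotalTheory.arg_minP (fun T => phi A b lambda (f T))
  (P0 : (fun T : {set 'I_n} => #|T :\: S| <= s)%N finset.set0)) => T hT Tmin.
exists (f T).
  by apply: leq_trans hT; rewrite subset_leq_card// finset.setSD// (hf T).1.
by move=> y /Tmin /le_trans; apply; exact: (hf _).2.
Qed.

End SparseMinimizer.

(** * Error bounds and sparsity of proximal steps *)

Section SparseRecovery.
Context {R : realType} {m n : nat}.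
Variables (A : 'M[R]_(m, n)) (b z : 'cV[R]_m) (xbar : 'cV[R]_n).
Variables (gamma delta lambda : R) (st : nat).
Let S := supp xbar.
Let nu := `|A^T *m z|.
Let rho := rho_minus A (#|S| + st).
Let radius := (1 + gamma) * lambda * #|S|%:R / rho.

Hypothesis hb : b = A *m xbar + z.
Hypothesis lambda_gt0 : 0 < lambda.
Hypothesis rho_gt0 : 0 < rho.
Hypothesis gamma_gt1 : 1 < gamma.

Definition err_on (x : 'cV[R]_n) := \sum_(j in S) `|(x - xbar) j 0|.
Definition err_off (x : 'cV[R]_n) := \sum_(j in ~: S) `|(x - xbar) j 0|.
Definition sublevel (x : 'cV[R]_n) :=
  phi A b lambda x <= phi A b lambda xbar + 2 * lambda * radius.

Lemma gamma1_ge0 : 0 <= 1 + gamma.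
Proof. by move: gamma_gt1; lra. Qed.

Lemma err_on_ge0 x : 0 <= err_on x. Proof. exact: sumr_ge0. Qed.

Lemma err_off_ge0 x : 0 <= err_off x. Proof. exact: sumr_ge0. Qed.

Lemma l1norm_err x : l1norm (x - xbar) = err_on x + err_off x.
Proof.
rewrite /l1norm (bigID (mem S)) /=; congr (_ + _).
by apply: eq_bigl => j; rewrite finset.in_setC.
Qed.

(** On S the norm drops by at most the error; off S, where xbar vanishes, it
    grows by exactly the error. *)
Lemma l1norm_gap x : err_off x - err_on x <= l1norm x - l1norm xbar.
Proof.
rewrite -sumrB [leRHS](bigID (mem S)) /= addrC; apply: lerD; last first.
  rewrite /err_on -sumrN; apply: ler_sum => j _.
  by rewrite !mxE lerNl opprB distrC lerB_dist.
rewrite le_eqVlt; apply/orP; left; apply/eqP.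
apply: eq_big => [j|j]; first by rewrite finset.in_setC.
by rewrite finset.in_setC inE negbK !mxE => /eqP ->; rewrite normr0 !subr0.
Qed.

(** The exact expansion of f at xbar, where the gradient is - A^T z, with the
    noise term bounded by Hoelder. *)
Lemma phi_excess_ge x :
  2^-1 * sqnorm2 (A *m (x - xbar)) - nu * (err_on x + err_off x)
    + lambda * (err_off x - err_on x) <= phi A b lambda x - phi A b lambda xbar.
Proof.
rewrite /phi (lsq_taylor A b xbar x) /grad_lsq.
have -> : A *m xbar - b = - z by rewrite hb opprD addrA subrr sub0r.
rewrite mulmxN dotvNl.
have lam := lambda_gt0.
have := dotv_le_norm (A^T *m z) (x - xbar).
rewrite l1norm_err -/nu => /(le_trans (ler_norm _)).
have := ler_wpM2l (ltW lambda_gt0) (l1norm_gap x); lra.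
Qed.

(** Cauchy-Schwarz on S followed by restricted strong convexity. *)
Lemma err_on_sqr_le x : sparse_off S st x ->
  (1 + gamma) * lambda * err_on x ^+ 2 <= radius * sqnorm2 (A *m (x - xbar)).
Proof.
move=> hx; set q := sqnorm2 _.
have hs : (l0norm (x - xbar) <= #|S| + st)%N.
  rewrite -[X in (_ + X)%N]addn0; apply: l0normB => //.
  by rewrite /sparse_off finset.setDv cards0.
have h1 : rho * sqnorm2 (x - xbar) <= q := rho_minus_le A hs.
have h2 : err_on x ^+ 2 <= #|S|%:R * sqnorm2 (x - xbar).
  exact: sqr_sum_le_card_sqnorm2.
have h3 : err_on x ^+ 2 * rho <= #|S|%:R * q.
  rewrite (le_trans (ler_wpM2r (ltW rho_gt0) h2))//.
  by rewrite -mulrA ler_wpM2l// mulrC.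
have er : radius * rho = (1 + gamma) * lambda * #|S|%:R by rewrite divfK ?gt_eqF.
rewrite -(ler_pM2r rho_gt0) [leRHS]mulrAC er -!(mulrA ((1 + gamma) * lambda)).
by rewrite ler_wpM2l// mulr_ge0 ?(ltW lambda_gt0)// gamma1_ge0.
Qed.

Lemma radius_ge0 : 0 <= radius.
Proof.
by rewrite divr_ge0 ?(ltW rho_gt0)// !mulr_ge0 ?gamma1_ge0 ?(ltW lambda_gt0).
Qed.

(** Combining [omega_descent] at xbar with [phi_excess_ge] gives
    |A e|^2 + ((1 - delta) lambda - nu) |e_off| <= ((1 + delta) lambda + nu) |e_on|.
    The condition on nu turns this into the cone condition |e_off| <= gamma |e_on|
    and into |A e|^2 <= 2 lambda |e_on|; with [err_on_sqr_le] the latter bounds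
    (1 + gamma) |e_on| by twice the radius. *)
Lemma sublevel_of_small_residue x : 0 < delta < 1 ->
  0 < (1 - delta) * gamma - (1 + delta) ->
  (gamma + 1) * nu <= ((1 - delta) * gamma - (1 + delta)) * lambda ->
  omega A b lambda x <= delta * lambda -> sparse_off S st x -> sublevel x.
Proof.
move=> /andP[d0 d1] hg hnu hom hx.
have lam := lambda_gt0; have gam := gamma_gt1.
have hq := omega_descent (ltW lambda_gt0) hom xbar.
have h := phi_excess_ge x.
have ha := err_on_ge0 x; have hc := err_off_ge0 x.
have hr := err_on_sqr_le hx.
have e1 : l1norm (xbar - x) = err_on x + err_off x.
  by rewrite -l1norm_err -opprB -scaleN1r l1normZ normrN1 mul1r.
have e2 : sqnorm2 (A *m (xbar - x)) = sqnorm2 (A *m (x - xbar)).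
  by rewrite !mulmxBr sqnorm2B.
rewrite e1 e2 in hq.
have q0 := sqnorm2_ge0 (A *m (x - xbar)).
rewrite /sublevel.
set a := err_on x in h ha hr hq *; set c := err_off x in h hc hq *.
set q := sqnorm2 _ in h hr hq q0.
have g1 : 0 < gamma + 1 by lra.
have hnu1 : nu < (1 - delta) * lambda.
  rewrite -(ltr_pM2l g1); apply: (le_lt_trans hnu).
  rewrite mulrA ltr_pM2r//; lra.
have k1 : q + ((1 - delta) * lambda - nu) * c <= ((1 + delta) * lambda + nu) * a.
  lra.
have k2 : c <= gamma * a.
  have p : 0 < (1 - delta) * lambda - nu by lra.
  rewrite -(ler_pM2l p).
  have : ((1 + delta) * lambda + nu) * a <= ((1 - delta) * lambda - nu) * gamma * a.
    by rewrite ler_wpM2r//; lra.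
  lra.
have k3 : q <= 2 * lambda * a.
  have : ((1 + delta) * lambda + nu) * a <= 2 * lambda * a by rewrite ler_wpM2r//; lra.
  have : 0 <= ((1 - delta) * lambda - nu) * c by rewrite mulr_ge0//; lra.
  lra.
have k4 : (1 + gamma) * a <= 2 * radius.
  have [a0|a0] := eqVneq a 0; first by rewrite a0 mulr0 mulr_ge0 ?radius_ge0.
  have a1 : 0 < lambda * a by rewrite mulr_gt0// lt_neqAle eq_sym a0.
  rewrite -(ler_pM2l a1).
  have := ler_wpM2l radius_ge0 k3; lra.
have k5 : delta * lambda * (a + c) <= lambda * ((1 + gamma) * a).
  have h1 : a + c <= (1 + gamma) * a by lra.
  apply: le_trans (_ : lambda * (a + c) <= _); last by rewrite ler_pM2l.
  by rewrite ler_wpM2r ?addr_ge0// ler_piMl ?ltW.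
have := ler_wpM2l (ltW lambda_gt0) k4; lra.
Qed.

Hypothesis nu_small : 4 * nu <= lambda.

(** With nu <= lambda / 4 the excess bound reads
    |A e|^2 / 2 + 3/4 lambda |e_off| <= 2 lambda D + 5/4 lambda |e_on| with D the
    radius. Since (5/4 lambda |e_on|)^2 <= 2 lambda D |A e|^2 by [err_on_sqr_le],
    the last term is absorbed by |A e|^2 and lambda D. *)
Lemma sublevel_errors x : sparse_off S st x -> sublevel x ->
  err_off x <= 4 * radius /\
  sqnorm2 (A *m (x - xbar)) <= 16 * lambda * radius.
Proof.
move=> hx hphi.
have lam := lambda_gt0; have gam := gamma_gt1; have nus := nu_small.
have h := phi_excess_ge x.
have ha := err_on_ge0 x; have hc := err_off_ge0 x.
have hr := err_on_sqr_le hx.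
have q0 := sqnorm2_ge0 (A *m (x - xbar)).
rewrite /sublevel in hphi.
set a := err_on x in h ha hr *; set c := err_off x in h hc *.
set q := sqnorm2 _ in h hr q0 *.
have r0 : 0 <= lambda * radius by rewrite mulr_ge0 ?radius_ge0 ?ltW.
have base : 2^-1 * q + 3 / 4 * lambda * c <= 2 * lambda * radius + 5 / 4 * lambda * a.
  have : 4 * nu * (a + c) <= lambda * (a + c) by rewrite ler_wpM2r ?addr_ge0.
  lra.
have a2 : (5 / 4 * lambda * a) ^+ 2 <= 2 * (lambda * radius) * q.
  have h1 : 2 * (lambda * a ^+ 2) <= (1 + gamma) * (lambda * a ^+ 2).
    by apply: ler_wpM2r; [rewrite mulr_ge0 ?sqr_ge0 ?(ltW lam) | lra].
  have h2 : 2 * (lambda * a ^+ 2) <= radius * q by lra.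
  have h3 := ler_wpM2l (ltW lambda_gt0) h2.
  have h4 : 0 <= lambda * (radius * q) by rewrite mulrA mulr_ge0.
  lra.
have la0 : 0 <= 5 / 4 * lambda * a by rewrite mulr_ge0// mulr_ge0 ?ltW//; lra.
(* AM-GM: two different splittings u + v of the same product bound the error. *)
have bnd u v : 0 <= u -> 0 <= v -> 2 * (lambda * radius) * q <= 4 * (u * v) ->
    5 / 4 * lambda * a <= u + v.
  move=> u0 v0 huv; rewrite -ler_sqr ?nnegrE ?addr_ge0//.
  have := sqr_ge0 (u - v); lra.
have b1 : 5 / 4 * lambda * a <= lambda * radius + 2^-1 * q.
  by apply: bnd => //; lra.
have b2 : 5 / 4 * lambda * a <= 2 * lambda * radius + 4^-1 * q.
  by apply: bnd; lra.
have lc0 : 0 <= lambda * c by rewrite mulr_ge0 ?(ltW lam).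
split; last lra.
rewrite -(ler_pM2l lambda_gt0); lra.
Qed.

Variable K : R.
Let rp := rho_plus A st.
Hypothesis st_large : 16 * (K + 2 * rp) * radius < lambda * st%:R.

(** Here v = L x - grad f(x) splits as L x - A^T A e + A^T z. Pairing with the
    sign vector u of v on st surviving entries off S bounds the three parts by
    L |e_off|_1, by |A u| |A e|, and by nu st. *)
Lemma prox_step_sparse L x y : 0 < L <= K -> sparse_off S st x -> sublevel x ->
  is_prox_step A b lambda L x y -> sparse_off S st y.
Proof.
move=> /andP[L0 LK] hx hphi hy; rewrite /sparse_off leqNgt; apply/negP => hlt.
have [hc hq] := sublevel_errors hx hphi.
have [l [lu lsz lU]] := card_geqP (ltnW hlt).
set T : {set 'I_n} := [set j in l]%SET.
have cT : #|T| = st by rewrite cardsE (card_uniqP lu).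
have TU j : j \in T -> j \notin S /\ y j 0 != 0.
  by rewrite inE => /lU; rewrite finset.in_setD => /andP[-> ]; rewrite inE.
set v := L *: x - grad_lsq A b x; set u := signv T v.
have low : lambda * st%:R <= dotv u v.
  rewrite dotv_signv -cT -sum1_card natr_sum mulr_sumr; apply: ler_sum => j jT.
  rewrite mulr1 !mxE.
  have := prox_step_threshold (ltW L0) hy (TU j jT).2.
  by rewrite mxE.
have vE : v = L *: x - A^T *m (A *m (x - xbar)) + A^T *m z.
  rewrite /v /grad_lsq hb -addrA; congr (_ + _).
  have -> : A *m x - (A *m xbar + z) = A *m (x - xbar) - z.
    by rewrite mulmxBr opprD addrA.
  by rewrite mulmxBr opprB addrC.
have ux : dotv u x <= err_off x.
  rewrite /dotv /err_off [leRHS]big_mkcond; apply: ler_sum => j _.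
  rewrite mxE; case: ifP => jT; last by rewrite mul0r; case: ifP.
  have [jS _] := TU j jT; rewrite finset.in_setC jS.
  have xb0 : xbar j 0 = 0 by apply/eqP; move: jS; rewrite inE negbK.
  rewrite [(x - xbar) j 0]mxE [(- xbar) j 0]mxE xb0 subr0.
  rewrite (le_trans (ler_norm _))// normrM.
  by rewrite ler_piMl// normr_sg lern1 leq_b1.
have uz : dotv u (A^T *m z) <= nu * st%:R.
  rewrite dotvC (le_trans (ler_norm _))// (le_trans (dotv_le_norm _ _))//.
  by rewrite ler_wpM2l// -cT l1norm_signv.
have rp0 : 0 <= rp := rho_plus_ge0 A st.
have large := st_large.
have ue : - dotv (A *m u) (A *m (x - xbar)) <= lambda * st%:R / 2 + 8 * rp * radius.
  have u1 : sqnorm2 (A *m u) <= rp * st%:R.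
    apply: le_trans (rho_plus_ge A (_ : l0norm u <= st)%N) _.
      by rewrite -[leqRHS]cT subset_leq_card ?supp_signv.
    by rewrite ler_wpM2l// -cT sqnorm2_signv.
  rewrite (le_trans (ler_norm _))// normrN.
  have w0 : 0 <= lambda * st%:R / 2 + 8 * rp * radius.
    by rewrite addr_ge0// ?divr_ge0// mulr_ge0 ?radius_ge0 ?(ltW lambda_gt0) ?mulr_ge0.
  rewrite -ler_sqr ?nnegrE//.
  rewrite real_normK ?num_real// (le_trans (dotv_cauchy_schwarz _ _))//.
  apply: le_trans (ler_pM (sqnorm2_ge0 _) (sqnorm2_ge0 _) u1 hq) _.
  have := sqr_ge0 (lambda * st%:R / 2 - 8 * rp * radius); lra.
have nus : 4 * nu * st%:R <= lambda * st%:R by rewrite ler_wpM2r.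
have Lc : L * dotv u x <= K * (4 * radius).
  apply: le_trans (ler_wpM2l (ltW L0) (le_trans ux hc)) _.
  by rewrite ler_wpM2r// mulr_ge0// radius_ge0.
have uvE : dotv u v = L * dotv u x - dotv (A *m u) (A *m (x - xbar)) +
    dotv u (A^T *m z).
  rewrite vE !dotvDr dotvNr dotvZr (dotvC u (A^T *m (A *m _))) dotv_trmx.
  by rewrite (dotvC (A *m u)).
rewrite uvE in low; lra.
Qed.

End SparseRecovery.

(** * Line search and contraction *)

Section Iteration.
Context {R : realType} {m n : nat}.
Variables (A : 'M[R]_(m, n)) (b : 'cV[R]_m) (lambda ginc : R).
Variables (S : {set 'I_n}) (st : nat) (v : R).
Let K := ginc * rho_plus A (#|S| + 2 * st).
Let mu := rho_minus A (#|S| + 2 * st).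

Hypothesis lambda_gt0 : 0 < lambda.
Hypothesis ginc_gt1 : 1 < ginc.
Hypothesis mu_gt0 : 0 < mu.

(** The threshold v enters the analysis of the iteration only through the
    hypothesis [prox_sparse], that proximal steps from the region stay sparse. *)
Definition in_region (x : 'cV[R]_n) :=
  sparse_off S st x /\ phi A b lambda x <= v.

Hypothesis prox_sparse : forall L x y, 0 < L <= K -> in_region x ->
  is_prox_step A b lambda L x y -> sparse_off S st y.

Lemma sparse_diff x y : in_region x -> sparse_off S st y ->
  (l0norm (y - x) <= #|S| + 2 * st)%N.
Proof. by move=> [xs _] ys; rewrite mul2n -addnn; exact: l0normB. Qed.

(** A rejected L is smaller than rho_plus, because the model dominates phi along
    sparse directions once L reaches rho_plus; so L * ginc <= K after a retry. *)
Lemma line_search_region L x y M : 0 < L <= K -> in_region x ->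
  line_search A b ginc lambda x L y M ->
  [/\ 0 < M <= K, in_region y,
      is_prox_step A b lambda M x y &
      phi A b lambda y <= psi A b lambda M x y].
Proof.
move=> hL hx hls.
elim: hls hL => {L y M} [L y hy acc hL|L t y M ht rej _ ih /andP[L0 LK]].
  split=> //; split; first exact: prox_sparse hx hy.
  rewrite (le_trans acc)// (le_trans (hy x))// psi_self; exact: hx.2.
have ts : sparse_off S st t by apply: (prox_sparse _ hx ht); rewrite L0.
have ginc0 : 0 < ginc by rewrite (lt_trans ltr01).
apply: ih; rewrite mulr_gt0//= mulrC ler_pM2l// leNgt; apply/negP => hlt.
move: rej; rewrite ltNge => /negP; apply.
have hq := rho_plus_ge A (sparse_diff hx ts).
have : rho_plus A (#|S| + 2 * st) * sqnorm2 (t - x) <= L * sqnorm2 (t - x).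
  by rewrite ler_wpM2r ?sqnorm2_ge0 ?ltW.
rewrite (phi_psi A b lambda L x t); lra.
Qed.

Lemma mu_le_rho_plus : mu <= rho_plus A (#|S| + 2 * st).
Proof. exact: rho_minus_le_plus. Qed.

(** With t the proximal step from the sparse minimizer xs for L = rho_plus,
    psi (xs, xs) = phi xs <= phi t <= psi (xs, t) = min psi (xs, .), so xs minimizes
    its own model. *)
Lemma region_minimizer x0 : in_region x0 -> exists2 xs : 'cV[R]_n, in_region xs &
  forall y, phi A b lambda xs + 2^-1 * sqnorm2 (A *m (y - xs)) <= phi A b lambda y.
Proof.
move=> [x0s x0v].
have [xs xss xsmin] := sparse_minimizer A b lambda_gt0 S st.
have hxs : in_region xs by split=> //; rewrite (le_trans (xsmin _ x0s)).
exists xs => //.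
set L := rho_plus A (#|S| + 2 * st).
have L0 : 0 < L by rewrite (lt_le_trans mu_gt0)// mu_le_rho_plus.
have [t ht] := prox_step_exists A b (ltW lambda_gt0) xs L0.
have ts : sparse_off S st t.
  apply: (prox_sparse _ hxs ht); rewrite L0 /K -/L.
  by rewrite ler_peMl ?ltW.
have hq := rho_plus_ge A (sparse_diff hxs ts).
apply: (@prox_fixpoint_growth _ _ _ A b lambda (ltW lambda_gt0) L) => y.
apply: le_trans (ht y); rewrite psi_self (le_trans (xsmin _ ts))//.
rewrite (phi_psi A b lambda L xs t); rewrite -/L in hq; lra.
Qed.

Lemma phi_star_min xs : (forall y, phi A b lambda xs <= phi A b lambda y) ->
  phi_star A b lambda = phi A b lambda xs.
Proof.
move=> h; apply/eqP; rewrite eq_le; apply/andP; split.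
  by apply: ge_inf; [exists (phi A b lambda xs) => _ [y _ <-] | exists xs].
by apply: lb_le_inf; [exists (phi A b lambda xs); exists xs | move=> _ [y _ <-]].
Qed.

(** The model at x + a (xs - x) is at most
    (1 - a) phi x + a phi xs + a^2 M / 2 |xs - x|^2, and the growth of phi around xs
    together with restricted strong convexity bounds |xs - x|^2 by
    2 / mu (phi x - phi xs). *)
Lemma prox_step_contraction M x y : 0 < M <= K -> in_region x ->
  is_prox_step A b lambda M x y -> phi A b lambda y <= psi A b lambda M x y ->
  phi A b lambda y - phi_star A b lambda <=
    (1 - mu / (4 * K)) * (phi A b lambda x - phi_star A b lambda).
Proof.
move=> /andP[M0 MK] hx hy acc.
have [xs hxs growth] := region_minimizer hx.
have xsmin w : phi A b lambda xs <= phi A b lambda w.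
  by rewrite (le_trans _ (growth w))// lerDl mulr_ge0 ?invr_ge0 ?sqnorm2_ge0.
rewrite (phi_star_min xsmin).
set d := sqnorm2 (xs - x).
have sc : mu / 2 * d <= phi A b lambda x - phi A b lambda xs.
  have := rho_minus_le A (sparse_diff hxs hx.1).
  rewrite -/mu sqnorm2B -/d; have := growth x; lra.
have K0 : 0 < K by rewrite (lt_le_trans M0).
have muK : mu <= K.
  by rewrite (le_trans mu_le_rho_plus)// ler_peMl ?rho_plus_ge0// ltW.
(* This a minimizes the factor 1 - a + a^2 K / mu obtained below. *)
set a := mu / (2 * K).
have a0 : 0 <= a by rewrite divr_ge0 ?ltW// mulr_gt0.
have K20 : 0 < 2 * K by lra.
have a1 : a <= 1 by rewrite /a ler_pdivrMr//; lra.
have step : phi A b lambda y <=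
    (1 - a) * phi A b lambda x + a * phi A b lambda xs + a ^+ 2 * (M / 2 * d).
  rewrite (le_trans acc)// (le_trans (hy (x + a *: (xs - x))))//.
  rewrite /psi (addrAC x) subrr add0r dotvZr sqnorm2Z -/d.
  have a01 : 0 <= a <= 1 by rewrite a0.
  have := ler_wpM2l (ltW lambda_gt0) (l1norm_conv x xs a01).
  have q0 : 0 <= a * sqnorm2 (A *m (xs - x)) by rewrite mulr_ge0 ?sqnorm2_ge0.
  rewrite /phi (lsq_taylor A b x xs); lra.
have h1 : a ^+ 2 * (M / 2 * d) <= a ^+ 2 * (K / 2 * d).
  rewrite ler_wpM2l ?sqr_ge0// ler_wpM2r ?sqnorm2_ge0//; lra.
have h2 : a ^+ 2 * (K / 2 * d) = a / 2 * (mu / 2 * d).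
  by rewrite /a; field; rewrite gt_eqF.
have h3 := ler_wpM2l (divr_ge0 a0 (ler0n _ 2)) sc.
have -> : mu / (4 * K) = a / 2 by rewrite /a; field; rewrite gt_eqF.
lra.
Qed.

End Iteration.

(** * Linear convergence *)

(* hL0max (the same upper bound as for Lmin) is needed: the line search never
   decreases L, so with an arbitrarily large L0 the first steps are arbitrarily
   short and the contraction factor fails already at k = 1. *)
Theorem theorem1 (R : realType) (m n : nat) (A : 'M[R]_(m, n))
    (b z : 'cV[R]_m) (xbar : 'cV[R]_n)
    (gamma delta' lambda_tgt : R) (st : nat) (ginc gdec Lmin : R)
    (sbar := #|supp xbar|)
    (hb : b = A *m xbar + z)
    (hginc : 1 < ginc) (hgdec : 1 <= gdec) (hltgt : 0 < lambda_tgt)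
    (hgamma : 0 < gamma) (hdelta : 0 < delta' < 1)
    (hgd : (1 + delta') / (1 - delta') < gamma)
    (hlz : Num.max 4 ((gamma + 1) / ((1 - delta') * gamma - (1 + delta')))
             * `|A^T *m z| <= lambda_tgt)
    (hrho : 0 < rho_minus A (sbar + 2 * st)%N)
    (hst : 16 * (ginc * rho_plus A (sbar + 2 * st)%N + 2 * rho_plus A st)
             / rho_minus A (sbar + st)%N * (1 + gamma) * sbar%:R < st%:R)
    (hLmin : 0 < Lmin <= ginc * rho_plus A (sbar + 2 * st)%N)
    (lambda : R) (hlambda : lambda_tgt <= lambda)
    (L0 : R) (hL0 : Lmin <= L0)
    (hL0max : L0 <= ginc * rho_plus A (sbar + 2 * st)%N)
    (x : nat -> 'cV[R]_n)
    (hx : prox_grad_run A b ginc gdec Lmin lambda L0 x)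
    (hsparse0 : (l0norm (vrestrict (~: supp xbar)%SET (x 0%N)) <= st)%N)
    (homega0 : omega A b lambda (x 0%N) <= delta' * lambda)
    (kappa := rho_plus A (sbar + 2 * st)%N / rho_minus A (sbar + 2 * st)%N) :
  forall k : nat,
    (l0norm (vrestrict (~: supp xbar)%SET (x k)) <= st)%N /\
    phi A b lambda (x k) - phi_star A b lambda
      <= (1 - 1 / (4 * ginc * kappa)) ^+ k
         * (phi A b lambda (x 0%N) - phi_star A b lambda).
Proof.
have [/andP[d0 d1] /andP[Lmin0 LminK]] := (hdelta, hLmin).
pose S := supp xbar; set nu := `|A^T *m z| in hlz.
pose K := ginc * rho_plus A (#|S| + 2 * st).
have lam : 0 < lambda := lt_le_trans hltgt hlambda.
have d1' : 0 < 1 - delta' by rewrite subr_gt0.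
have den : 0 < (1 - delta') * gamma - (1 + delta').
  by rewrite ltr_pdivrMr// in hgd; lra.
have gam : 1 < gamma.
  by apply: lt_trans hgd; rewrite ltr_pdivlMr//; lra.
have nu0 : 0 <= nu := normr_ge0 _.
have nu4 : 4 * nu <= lambda.
  apply: le_trans hlambda; apply: le_trans hlz.
  by rewrite ler_wpM2r// le_max lexx.
have nug : (gamma + 1) * nu <= ((1 - delta') * gamma - (1 + delta')) * lambda.
  rewrite -ler_pdivrMl// mulrC mulrAC.
  apply: le_trans hlambda; apply: le_trans hlz.
  by rewrite ler_wpM2r// le_max lexx orbT.
have ginc0 : 0 < ginc := lt_trans ltr01 hginc.
have K0 : 0 < K := lt_le_trans (lt_le_trans Lmin0 hL0) hL0max.
have st0 : (0 < st)%N.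
  rewrite -(ltr0n R); apply: le_lt_trans hst.
  rewrite !mulr_ge0 ?invr_ge0 ?rho_minus_ge0 ?addr_ge0 ?mulr_ge0 ?rho_plus_ge0//;
    lra.
have rho0 : 0 < rho_minus A (#|S| + st).
  apply: (lt_le_trans hrho); apply: rho_minus_anti hrho.
  by rewrite addn_gt0 st0 orbT leq_add2l leq_pmull.
set radius := (1 + gamma) * lambda * #|S|%:R / rho_minus A (#|S| + st).
have large : 16 * (K + 2 * rho_plus A st) * radius < lambda * st%:R.
  rewrite -(ltr_pM2l lam) in hst; apply: le_lt_trans hst.
  by rewrite le_eqVlt /radius /K /sbar /S; apply/orP; left; apply/eqP; ring.
pose good := in_region A b lambda S st (phi A b lambda xbar + 2 * lambda * radius).
have keep L u w : 0 < L <= K -> good u -> is_prox_step A b lambda L u w ->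
    sparse_off S st w.
  move=> hL [us uv]; exact: (prox_step_sparse hb lam rho0 gam nu4 large hL us uv).
have good0 : good (x 0%N).
  rewrite l0norm_vrestrictC in hsparse0; split=> //.
  exact: (sublevel_of_small_residue hb lam rho0 gam hdelta den nug homega0 hsparse0).
have [Ls [M [Ls0 run]]] := hx.
have inv k : good (x k) /\ Lmin <= Ls k <= K.
  elim: k => [|k [gk /andP[Lk LkK]]]; first by rewrite Ls0 hL0.
  have [ls ->] := run k.
  have Lk0 : 0 < Ls k <= K by rewrite (lt_le_trans Lmin0).
  have [/andP[M0 MK] gk1 _ _] := line_search_region hginc keep Lk0 gk ls.
  split=> //; rewrite le_max lexx /= ge_max LminK /=.
  apply: le_trans MK; rewrite ler_pdivrMr ?(lt_le_trans ltr01)//.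
  by rewrite ler_peMr ?(ltW M0).
have rate : 1 / (4 * ginc * kappa) = rho_minus A (#|S| + 2 * st) / (4 * K).
  have rp0 : 0 < rho_plus A (#|S| + 2 * st).
    by rewrite (lt_le_trans hrho)// rho_minus_le_plus.
  by rewrite /kappa /K /sbar; field; rewrite !gt_eqF.
move=> k; rewrite l0norm_vrestrictC; split; first exact: (inv k).1.1.
elim: k => [|k ih]; first by rewrite expr0 mul1r.
have [gk /andP[Lk LkK]] := inv k.
have Lk0 : 0 < Ls k <= K by rewrite (lt_le_trans Lmin0).
have [MK _ px acc] := line_search_region hginc keep Lk0 gk (run k).1.
have := prox_step_contraction lam hginc hrho keep MK gk px acc.
rewrite -rate => /le_trans; apply; rewrite exprS -[leRHS]mulrA ler_wpM2l//.
have K4 : 0 < 4 * K by lra.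
rewrite subr_ge0 rate ler_pdivrMr//.
have : rho_minus A (#|S| + 2 * st) <= K.
  apply: le_trans (rho_minus_le_plus hrho) _.
  by rewrite ler_peMl ?rho_plus_ge0// ltW.
lra.
Qed.
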